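(* Let $(\Omega,\mathcal F,\mathbb P,\{\mathcal F_t\}_{t\ge0})$ be a filtered probability space. Let $X:\Omega\times[0,\infty)\to\mathbb R^+\cup\{\infty\}$ be an increasing càdlàg stochastic process and define, for $M>0$, $$\sigma_M=\inf\{r\ge0:X(r)\ge M\}.$$ Suppose that there exists an increasing sequence of stopping times $\tau_n$ such that $\tau_n\uparrow\infty$ a.s. and such that for any fixed $n>0$ and $t>0$, $$\kappa_{n,t}:=\sup_M\mathbb E\,X(\tau_n\wedge\sigma_M\wedge t)<\infty.$$ Then there is a set $\tilde\Omega\subset\Omega$ of full measure such that $$X(t,\omega)<\infty\quad\text{for all }t\in[0,\infty),\ \omega\in\tilde\Omega .$$
   Context: ''Increasing'' means nondecreasing in time along each path; $\inf\emptyset=+\infty$; $a\wedge b=\min(a,b)$. The supremum over $M$ is over all $M>0$. *)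

(* Defs.v *)
From HB Require Import structures.
From mathcomp Require Import all_boot all_order all_algebra.
From mathcomp Require Import all_classical all_reals all_analysis measurable_realfun.

Set Implicit Arguments.
Unset Strict Implicit.
Unset Printing Implicit Defensive.

Import Order.TTheory GRing.Theory Num.Theory.
Import numFieldNormedType.Exports.

Local Open Scope classical_set_scope.
Local Open Scope ring_scope.
Local Open Scope ereal_scope.

(* The time set [0, oo) is the nonnegative part of R: families indexed by time
   are functions on R of which only the values at nonnegative times matter.
   Random times take their values in [0, +oo], as elements of \bar R. *)

Section processes.
Context (d : measure_display) (T : measurableType d) (R : realType).

Definition filtration (F : R -> set_system T) : Prop :=
  [/\ forall t : R, (0 <= t)%R -> sigma_algebra setT (F t),
      forall t : R, (0 <= t)%R -> F t `<=` measurable &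
      forall s t : R, (0 <= s)%R -> (s <= t)%R -> F s `<=` F t].

Definition stopping_time (F : R -> set_system T) (tau : T -> \bar R) : Prop :=
  (forall w, 0 <= tau w) /\
  (forall t : R, (0 <= t)%R -> F t [set w | tau w <= t%:E]).

(* Only measurability with respect to the ambient sigma-algebra is required of
   a process; in particular it need not be adapted. *)
Definition nonneg_process (X : R -> T -> \bar R) : Prop :=
  (forall t : R, (0 <= t)%R -> measurable_fun setT (X t)) /\
  (forall (t : R) w, (0 <= t)%R -> 0 <= X t w).

Definition increasing_paths (X : R -> T -> \bar R) : Prop :=
  forall w (s t : R), (0 <= s)%R -> (s <= t)%R -> X s w <= X t w.

(* Limits are taken in the extended real line, so a path may jump to +oo or
   increase to +oo continuously. *)
Definition cadlag_paths (X : R -> T -> \bar R) : Prop :=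
  forall w,
    (forall t : R, (0 <= t)%R -> X s w @[s --> t^'+] --> X t w) /\
    (forall t : R, (0 < t)%R -> cvg (X s w @[s --> t^'-])).

Definition hitting_time (X : R -> T -> \bar R) (M : R) (w : T) : \bar R :=
  ereal_inf [set r%:E | r in [set r : R | (0 <= r)%R /\ M%:E <= X r w]].

(* The random time being evaluated lies in [0, t] as soon as tau is
   nonnegative, so fine does not alter it. *)
Definition kappa (P : probability T R) (X : R -> T -> \bar R)
    (tau : nat -> T -> \bar R) (n : nat) (t : R) : \bar R :=
  ereal_sup
    [set \int[P]_w X (fine (mine (mine (tau n w) (hitting_time X M w)) t%:E)) w
    | M in [set M : R | (0 < M)%R]].

End processes.

(* Main.v *)
(* If X(t) = +oo and tau_n > t, then sigma_M <= t for every M, so that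
   tau_n /\ sigma_M /\ t = sigma_M, and X(sigma_M) >= M by right-continuity.
   Markov's inequality gives M P(X(t) = +oo, tau_n > t) <= kappa_{n,t} for all
   M > 0, hence this event is null; it remains to let n and t range over the
   positive integers. *)
Require Import Defs.
From HB Require Import structures.
From mathcomp Require Import all_boot all_order all_algebra.
From mathcomp Require Import all_classical all_reals all_analysis measurable_realfun.

Set Implicit Arguments.
Unset Strict Implicit.
Unset Printing Implicit Defensive.

Import Order.TTheory GRing.Theory Num.Theory.
Import numFieldNormedType.Exports.

Local Open Scope classical_set_scope.
Local Open Scope ring_scope.
Local Open Scope ereal_scope.

(* [ge0_le_integral] without its measurability hypotheses, as the randomly
   stopped process is not shown to be measurable. *)
Lemma ge0_le_integralT (d : measure_display) (T : measurableType d)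
    (R : realType) (mu : {measure set T -> \bar R}) (f g : T -> \bar R) :
  (forall x, 0 <= f x) -> (forall x, f x <= g x) ->
  \int[mu]_x f x <= \int[mu]_x g x.
Proof.
move=> f0 fg; have g0 x : 0 <= g x by exact: le_trans (f0 x) (fg x).
rewrite !ge0_integralTE//; apply: ereal_sup_le => _ [h /= hf <-].
by exists h => //= x; exact: le_trans (hf x) (fg x).
Qed.

(** Markov's inequality, by comparing [f] with [r] times the indicator of [A]. The event [A] is
    given separately because [f] will be the stopped process, whose level sets are not known to be
    measurable. *)
Lemma ge0_mule_measure_le_integral (d : measure_display) (T : measurableType d)
    (R : realType) (mu : {measure set T -> \bar R}) (f : T -> \bar R)
    (A : set T) (r : R) :
  measurable A -> (0 <= r)%R -> (forall x, 0 <= f x) ->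
  (forall x, A x -> r%:E <= f x) -> r%:E * mu A <= \int[mu]_x f x.
Proof.
move=> mA r0 f0 Af.
have -> : r%:E * mu A = \int[mu]_x (r * \1_A x)%:E.
  rewrite (integralZl_indic _ (fun=> A))//; last by rewrite ltNge r0.
  by rewrite integral_indic// setIT.
apply: ge0_le_integralT => x; rewrite indicE;
  have [/set_mem Ax|_] := boolP (x \in A).
- by rewrite mulr1 lee_fin.
- by rewrite mulr0.
- by rewrite mulr1 Af.
- by rewrite mulr0.
Qed.

Section hitting_time.
Context (d : measure_display) (T : measurableType d) (R : realType).
Variables (X : R -> T -> \bar R) (M : R) (w : T).

Lemma hitting_time_ge0 : 0 <= hitting_time X M w.
Proof. by apply: le_ereal_inf_tmp => _ [r [r0 _] <-]; rewrite lee_fin. Qed.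

Lemma hitting_time_le (t : R) :
  (0 <= t)%R -> M%:E <= X t w -> hitting_time X M w <= t%:E.
Proof. by move=> t0 MX; apply: ereal_inf_lbound; exists t. Qed.

(* Right-continuity makes the infimum a minimum. *)
Lemma le_hitting_time (t : R) :
  increasing_paths X -> cadlag_paths X ->
  (0 <= t)%R -> M%:E <= X t w -> M%:E <= X (fine (hitting_time X M w)) w.
Proof.
move=> Xincr /(_ w)[Xrc _] t0 MX.
have sf : hitting_time X M w \is a fin_num.
  rewrite ge0_fin_numE; last exact: hitting_time_ge0.
  exact: le_lt_trans (hitting_time_le t0 MX) (ltry _).
have s0 : (0 <= fine (hitting_time X M w))%R.
  by rewrite fine_ge0// hitting_time_ge0.
apply: cvge_to_ge (Xrc _ s0) _.
near=> u.
(* A time [u] beyond the infimum lies above some [r] with [X r w >= M], and monotonicity carries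
   this bound from [r] to [u]. *)
have : hitting_time X M w < u%:E.
  by rewrite -(fineK sf) lte_fin; near: u; exact: nbhs_right_gt.
move=> /ereal_inf_lt[_ [r [r0 MXr] <-]]; rewrite lte_fin => /ltW ru.
exact: le_trans MXr (Xincr _ _ _ r0 ru).
Unshelve. all: by end_near. Qed.

End hitting_time.

Section explosion.
Context (d : measure_display) (T : measurableType d) (R : realType).
Context (P : probability T R) (X : R -> T -> \bar R).
Hypotheses (Xpos : nonneg_process X) (Xincr : increasing_paths X)
  (Xcadlag : cadlag_paths X).

Lemma measurable_explosion (t : R) :
  (0 <= t)%R -> measurable [set w | X t w = +oo].
Proof.
move=> t0; rewrite -[X in measurable X]setTI.
exact: (Xpos.1 t t0 measurableT _ (emeasurable_set1 +oo)).
Qed.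

Lemma mule_measure_explosion_le_kappa (tau : nat -> T -> \bar R) (n : nat)
    (t M : R) :
  (forall w, 0 <= tau n w) -> measurable [set w | t%:E < tau n w] ->
  (0 <= t)%R -> (0 < M)%R ->
  M%:E * P ([set w | t%:E < tau n w] `&` [set w | X t w = +oo]) <=
  kappa P X tau n t.
Proof.
move=> tau0 mtau t0 M0; apply: le_trans; last first.
  by apply: ereal_sup_ubound; exists M.
apply: ge0_mule_measure_le_integral.
- by apply: measurableI => //; exact: measurable_explosion.
- exact: ltW.
(* [X] is known to be nonnegative at nonnegative times, so the sign of the stopped time comes
   first. *)
- move=> w; apply: Xpos.2; apply: fine_ge0.
  by rewrite !le_min tau0 hitting_time_ge0 lee_fin.
- move=> w [/= ttau Xoo].
  have MX : M%:E <= X t w by rewrite Xoo leey.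
  have st := hitting_time_le t0 MX.
  rewrite (min_idPr (le_trans st (ltW ttau))) (min_idPl st).
  exact: le_hitting_time MX.
Qed.

Lemma measure_explosion_eq0 (tau : nat -> T -> \bar R) (n : nat) (t : R) :
  (forall w, 0 <= tau n w) -> measurable [set w | t%:E < tau n w] ->
  (0 <= t)%R -> kappa P X tau n t < +oo ->
  P ([set w | t%:E < tau n w] `&` [set w | X t w = +oo]) = 0.
Proof.
move=> tau0 mtau t0 kfin; set E := _ `&` _.
have bound M : (0 < M)%R -> M%:E * P E <= kappa P X tau n t.
  exact: mule_measure_explosion_le_kappa.
(* The bound at [M = 1] gives the sign of [kappa], hence its finiteness as a real number and the
   positivity of the level [M] chosen below. *)
have k0 : 0 <= kappa P X tau n t.
  by apply: le_trans (bound _ ltr01); rewrite mul1e.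
apply/eqP; rewrite eq_le measure_ge0 andbT leNgt; apply/negP => PE0.
have kf : kappa P X tau n t \is a fin_num by rewrite ge0_fin_numE.
have Pf : P E \is a fin_num.
  rewrite fin_num_measure//.
  by apply: measurableI => //; exact: measurable_explosion.
have p0 : (0 < fine (P E))%R by rewrite fine_gt0// PE0 ltey_eq Pf.
(* With [P E > 0], this level turns the bound into [kappa + 1 <= kappa]. *)
have := bound ((fine (kappa P X tau n t) + 1) / fine (P E))%R.
rewrite -(fineK Pf) -(fineK kf) -EFinM lee_fin /= divfK ?gt_eqF//.
rewrite divr_gt0 ?ltr_wpDl ?fine_ge0// => /(_ isT).
by rewrite leNgt ltrDl ltr01.
Qed.

End explosion.

Theorem proposition5p1 (d : measure_display) (T : measurableType d)
    (R : realType) (P : probability T R) (F : R -> set_system T)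
    (X : R -> T -> \bar R) (tau : nat -> T -> \bar R)
    (hF : filtration F)
    (hX : nonneg_process X)
    (hXincr : increasing_paths X)
    (hXcadlag : cadlag_paths X)
    (htau : forall n, (0 < n)%N -> stopping_time F (tau n))
    (htau_incr : forall m n, (0 < m)%N -> (m <= n)%N ->
      forall w, tau m w <= tau n w)
    (htau_cvg : {ae P, forall w, tau n w @[n --> \oo] --> +oo})
    (hkappa : forall (n : nat) (t : R), (0 < n)%N -> (0 < t)%R ->
      kappa P X tau n t < +oo) :
  exists Omega1 : set T,
    [/\ measurable Omega1, P Omega1 = 1 &
        forall (t : R) (w : T), (0 <= t)%R -> Omega1 w -> X t w < +oo].
Proof.
(* Both indices are shifted by one because the hypotheses concern [n > 0] and [t > 0]. *)
pose E n k := [set w | k.+1%:R%:E < tau n.+1 w] `&` [set w | X k.+1%:R w = +oo].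
have mtau n (t : R) : (0 <= t)%R -> measurable [set w | t%:E < tau n.+1 w].
  move=> t0; rewrite (_ : [set _ | _] = ~` [set w | tau n.+1 w <= t%:E]).
    case: hF => _ Fm _; apply: measurableC; apply: (Fm t t0).
    exact: (htau n.+1 isT).2.
  by apply/seteqP; split=> w /=; rewrite ltNge => /negP.
have mE n k : measurable (E n k).
  by apply: measurableI; [exact: mtau|exact: measurable_explosion].
have E0 n k : P (E n k) = 0.
  apply: measure_explosion_eq0 => //; first exact: (htau n.+1 isT).1.
  - exact: mtau.
  - exact: hkappa.
have : P.-negligible (\bigcup_n \bigcup_k E n k).
  apply: negligible_bigcup => n; apply: negligible_bigcup => k.
  exact: (negligibleP P (mE n k)).2 (E0 n k).
(* [N] is a measurable null set containing every [E n k] and every [w] at which [tau] fails to tend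
   to infinity. *)
move=> /(negligibleU htau_cvg)[N [mN PN subN]].
exists (~` N); split; first exact: measurableC.
  by rewrite probability_setC// [X in _ - X]PN sube0.
move=> t w t0 Nw; rewrite ltey; apply/eqP => Xoo; apply/Nw/subN.
have [cvg_tau|] := pselect (tau n w @[n --> \oo] --> +oo); last by left.
right.
(* Explosion by time [t] persists at any later integer time [k.+1]. *)
have [k tk] : exists k, (t <= k.+1%:R)%R.
  exists (Num.bound t); apply/ltW/(lt_le_trans (archi_boundP t0)).
  by rewrite ler_nat.
(* From rank [n] on, [tau] exceeds [k.+1]; rank [n.+1] is the one occurring in [E n k]. *)
have [n _ /(_ n.+1 (leqnSn n)) tau_k] := cvgey_gt cvg_tau k.+1%:R.
exists n => //; exists k => //; split=> //=; apply/eqP.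
by rewrite -leye_eq -Xoo; exact: hXincr.
Qed.
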